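(* Let $\mathcal{C}$ be a small category with a Grothendieck coverage $J$. If $X$ is a $J$-separated presheaf on $\mathcal{C}$, then $X^+$ is a $J$-sheaf.
   Context: $\mathbf{Pre}(\mathcal{C})$ is the category of presheaves of sets on $\mathcal{C}$; $y(U)$ is the representable presheaf. A sieve on $U$ is a subpresheaf $R \hookrightarrow y(U)$, equivalently a set of morphisms into $U$ closed under precomposition. For $g : V \to U$, $g^*(R) = \{f : W \to V \mid gf \in R\}$. A Grothendieck coverage $J$ assigns to each $U$ a set $J(U)$ of sieves on $U$ such that (G1) $y(U) \in J(U)$; (G2) if $R \in J(U)$ and $g : V \to U$, then $g^*(R) \in J(V)$; (G3) if $R \in J(U)$, $R'$ is a sieve on $U$, and $g^*(R') \in J(V)$ for every $g : V \to U$ in $R$, then $R' \in J(U)$. A presheaf $X$ is $J$-separated (respectively a $J$-sheaf) if for every $U$ and every $R \in J(U)$ the restriction map $X(U) \cong \mathbf{Pre}(\mathcal{C})(y(U), X) \to \mathbf{Pre}(\mathcal{C})(R, X)$ is injective (respectively bijective). The plus construction is $X^+(U) = \mathrm{colim}_{R \in J(U)^{op}} \mathbf{Pre}(\mathcal{C})(R, X)$, where $J(U)$ is ordered by inclusion: elements are classes $[m : R \to X]$ with $R \in J(U)$, where $m : R \to X$ and $n : R' \to X$ are identified if they agree on some $R'' \in J(U)$ with $R'' \subseteq R \cap R'$. For $f : V \to U$, $X^+(f)[m : R \to X] = [f^*(R) \to R \xrightarrow{m} X]$. *)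

(* Defs.v *)
From mathcomp Require Import all_boot.
From mathcomp Require Import generic_quotient boolp.

Set Implicit Arguments.
Unset Strict Implicit.
Unset Printing Implicit Defensive.

#[local] Obligation Tactic := idtac.

Declare Scope cat_scope.
Delimit Scope cat_scope with cat.
Local Open Scope cat_scope.

(* Smallness is a universe matter: objects and morphisms live in Type, and the
   definition of plus below forces their universes to be no larger than that of
   the sets of sections, so X^+ is again a presheaf in the same sense as X. *)
Record category := Category {
  obj :> Type;
  hom : obj -> obj -> Type;
  idm : forall A, hom A A;
  comp : forall A B C, hom B C -> hom A B -> hom A C;
  comp1m : forall A B (f : hom A B), comp (idm B) f = f;
  compm1 : forall A B (f : hom A B), comp f (idm A) = f;
  compA : forall A B C D (h : hom C D) (g : hom B C) (f : hom A B),
    comp h (comp g f) = comp (comp h g) f }.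

Arguments idm {c} A.
Notation "g ∘ f" := (comp g f) (at level 40, left associativity) : cat_scope.

Record presheaf (C : category) := Presheaf {
  sections :> C -> Type;
  restr : forall U V : C, hom V U -> sections U -> sections V;
  restr1 : forall (U : C) (x : sections U), restr (idm U) x = x;
  restrM : forall (U V W : C) (f : hom V U) (g : hom W V) (x : sections U),
    restr (f ∘ g) x = restr g (restr f x) }.

Arguments restr {C} X {U V} f x : rename.

Record nat_trans (C : category) (F G : presheaf C) := NatTrans {
  component :> forall U : C, F U -> G U;
  natural : forall (U V : C) (f : hom V U) (x : F U),
    component (restr F f x) = restr G f (component x) }.

Lemma nat_trans_ext (C : category) (F G : presheaf C) (m n : nat_trans F G) :
  (forall U (x : F U), m U x = n U x) -> m = n.
Proof.
case: m n => [m mP] [n nP] /= mn.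
have E : m = n by apply: functional_extensionality_dep => U; apply/funext/mn.
by subst n; congr NatTrans.
Qed.

Program Definition nat_comp (C : category) (F G H : presheaf C)
    (n : nat_trans G H) (m : nat_trans F G) : nat_trans F H :=
  {| component U x := n U (m U x) |}.
Next Obligation. by move=> C F G H n m U V f x /=; rewrite !natural. Qed.

Program Definition yoneda (C : category) (U : C) : presheaf C :=
  {| sections V := hom V U; restr _ _ g f := f ∘ g |}.
Next Obligation. by move=> C U V f /=; rewrite compm1. Qed.
Next Obligation. by move=> C U V W Z f g h /=; rewrite compA. Qed.

(* The map X(U) -> Pre(C)(y(U), X) of the Yoneda lemma. *)
Program Definition yoneda_elt (C : category) (X : presheaf C) (U : C) (x : X U)
    : nat_trans (yoneda U) X :=
  {| component V f := restr X f x |}.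
Next Obligation. by move=> C X U x V W g f /=; rewrite restrM. Qed.

Record sieve (C : category) (U : C) := Sieve {
  arrows :> forall V : C, hom V U -> Prop;
  sieve_closed : forall (V W : C) (f : hom V U) (g : hom W V),
    arrows f -> arrows (f ∘ g) }.

Lemma sieve_ext (C : category) (U : C) (R S : sieve U) :
  (forall V (f : hom V U), R V f <-> S V f) -> R = S.
Proof.
case: R S => [R RP] [S SP] /= RS.
have E : R = S.
  by apply: functional_extensionality_dep => V; apply/funext => f; apply/propext/RS.
by subst S; congr Sieve.
Qed.

Definition max_sieve (C : category) (U : C) : sieve U :=
  @Sieve C U (fun _ _ => True) (fun _ _ _ _ _ => I).

Definition subsieve (C : category) (U : C) (R S : sieve U) : Prop :=
  forall (V : C) (f : hom V U), R V f -> S V f.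

Program Definition sieve_pull (C : category) (U V : C) (g : hom V U)
    (R : sieve U) : sieve V :=
  {| arrows W f := R W (g ∘ f) |}.
Next Obligation.
by move=> C U V g R W Z f h /= Rf; rewrite compA; apply: sieve_closed.
Qed.

Record coverage (C : category) := Coverage {
  covers :> forall U : C, sieve U -> Prop;
  cov_max : forall U : C, covers (max_sieve U);
  cov_pull : forall (U V : C) (R : sieve U) (g : hom V U),
    covers R -> covers (sieve_pull g R);
  cov_local : forall (U : C) (R R' : sieve U), covers R ->
    (forall (V : C) (g : hom V U), R V g -> covers (sieve_pull g R')) ->
    covers R' }.

(* A sieve R on U, seen as a subpresheaf of y(U). *)
Program Definition sieve_psh (C : category) (U : C) (R : sieve U) : presheaf C :=
  {| sections V := {f : hom V U | R V f};
     restr V W g f := exist _ (sval f ∘ g) (sieve_closed g (proj2_sig f)) |}.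
Next Obligation. by move=> C U R V [f Rf]; apply: eq_exist; rewrite /= compm1. Qed.
Next Obligation.
by move=> C U R V W Z f g [h Rh]; apply: eq_exist; rewrite /= compA.
Qed.

Definition sieve_incl (C : category) (U : C) (R : sieve U)
    : nat_trans (sieve_psh R) (yoneda U) :=
  @NatTrans C (sieve_psh R) (yoneda U) (fun V f => sval f)
    (fun _ _ _ _ => erefl).

Definition sub_incl (C : category) (U : C) (R S : sieve U) (RS : subsieve R S)
    : nat_trans (sieve_psh R) (sieve_psh S) :=
  @NatTrans C (sieve_psh R) (sieve_psh S)
    (fun V f => exist _ (sval f) (RS V (sval f) (proj2_sig f)))
    (fun V W g f => @eq_exist _ _ _ _ _ _ erefl).

(* The canonical map g^*(R) -> R. *)
Program Definition pull_proj (C : category) (U V : C) (g : hom V U)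
    (R : sieve U) : nat_trans (sieve_psh (sieve_pull g R)) (sieve_psh R) :=
  {| component W f := exist _ (g ∘ sval f) (proj2_sig f) |}.
Next Obligation.
by move=> C U V g R W Z h [f Rf]; apply: eq_exist; rewrite /= compA.
Qed.

Definition sieve_restriction (C : category) (X : presheaf C) (U : C)
    (R : sieve U) (x : X U) : nat_trans (sieve_psh R) X :=
  nat_comp (yoneda_elt x) (sieve_incl R).

Definition separated (C : category) (J : coverage C) (X : presheaf C) : Prop :=
  forall (U : C) (R : sieve U), J U R -> injective (@sieve_restriction C X U R).

Definition sheaf (C : category) (J : coverage C) (X : presheaf C) : Prop :=
  forall (U : C) (R : sieve U), J U R -> bijective (@sieve_restriction C X U R).

Lemma cov_meet (C : category) (J : coverage C) (U : C) (R S : sieve U) :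
  J U R -> J U S ->
  exists T : sieve U, [/\ J U T, subsieve T R & subsieve T S].
Proof.
move=> JR JS.
have clos V W (f : hom V U) (g : hom W V) :
    R V f /\ S V f -> R W (f ∘ g) /\ S W (f ∘ g).
  by case=> Rf Sf; split; apply: sieve_closed.
exists (@Sieve C U (fun V f => R V f /\ S V f) clos).
split; [|by move=> V f []|by move=> V f []].
apply: (cov_local JR) => V g Rg.
suff -> : sieve_pull g (Sieve clos) = sieve_pull g S by apply: cov_pull.
by apply: sieve_ext => W f /=; split=> [[]//|Sgf]; split=> //; apply: sieve_closed.
Qed.

Section Plus.
Variables (C : category) (J : coverage C) (X : presheaf C).

(* A map m : R -> X with R in J(U), before passing to the colimit. *)
Record preplus (U : C) := PrePlus {
  pp_sieve : sieve U;
  pp_cov : J U pp_sieve;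
  pp_map : nat_trans (sieve_psh pp_sieve) X }.

Definition pp_equiv (U : C) (m n : preplus U) : Prop :=
  exists (T : sieve U) (TR : subsieve T (pp_sieve m))
         (TS : subsieve T (pp_sieve n)),
    J U T /\
    nat_comp (pp_map m) (sub_incl TR) = nat_comp (pp_map n) (sub_incl TS).

Definition pp_restr (U V : C) (f : hom V U) (m : preplus U) : preplus V :=
  PrePlus (cov_pull f (pp_cov m))
    (nat_comp (pp_map m) (pull_proj f (pp_sieve m))).

Lemma pp_equivP (U : C) (m n : preplus U) :
  pp_equiv m n <->
  exists T : sieve U, [/\ J U T, subsieve T (pp_sieve m),
    subsieve T (pp_sieve n) &
    forall V (f : hom V U) (p : pp_sieve m V f) (q : pp_sieve n V f), T V f ->
      pp_map m V (exist _ f p) = pp_map n V (exist _ f q)].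
Proof.
split=> [[T [TR [TS [JT E]]]]|[T [JT TR TS E]]].
  exists T; split=> // V f p q Tf.
  have := f_equal (fun k : nat_trans (sieve_psh T) X => k V (exist _ f Tf)) E.
  by rewrite /= (Prop_irrelevance (TR _ _ _) p) (Prop_irrelevance (TS _ _ _) q).
exists T, TR, TS; split=> //; apply: nat_trans_ext => V [f Tf] /=.
exact: E.
Qed.

Lemma pp_equiv_refl (U : C) (m : preplus U) : pp_equiv m m.
Proof. by exists (pp_sieve m), (fun _ _ p => p), (fun _ _ p => p); case: m. Qed.

Lemma pp_equiv_sym (U : C) (m n : preplus U) : pp_equiv m n -> pp_equiv n m.
Proof. by case=> T [TR [TS [JT E]]]; exists T, TS, TR. Qed.

Lemma pp_equiv_trans (U : C) (n m p : preplus U) :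
  pp_equiv m n -> pp_equiv n p -> pp_equiv m p.
Proof.
move=> /pp_equivP[T [JT TR TS E]] /pp_equivP[T' [JT' TR' TS' E']].
have [S [JS ST ST']] := cov_meet JT JT'.
apply/pp_equivP; exists S; split=> // [V f /ST/TR //|V f /ST'/TS' //|V f a b Sf].
have nf := TS _ _ (ST _ _ Sf).
by rewrite (E V f a nf (ST _ _ Sf)) (E' V f nf b (ST' _ _ Sf)).
Qed.

(* {classic _} makes preplus U a choiceType, as {eq_quot _} requires. *)
Definition pp_equivb (U : C) : rel {classic preplus U} :=
  fun m n => `[< pp_equiv m n >].

Lemma pp_equivb_refl (U : C) : reflexive (@pp_equivb U).
Proof. by move=> m; apply/asboolP/pp_equiv_refl. Qed.

Lemma pp_equivb_sym (U : C) : symmetric (@pp_equivb U).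
Proof.
by move=> m n; apply/asboolP/asboolP => /pp_equiv_sym.
Qed.

Lemma pp_equivb_trans (U : C) : transitive (@pp_equivb U).
Proof.
move=> n m p /asboolP mn /asboolP np.
by apply/asboolP/(pp_equiv_trans mn np).
Qed.

Canonical pp_equiv_rel (U : C) : equiv_rel {classic preplus U} :=
  EquivRel (@pp_equivb U) (@pp_equivb_refl U) (@pp_equivb_sym U)
    (@pp_equivb_trans U).

Definition plus_sections (U : C) : Type := {eq_quot (pp_equiv_rel U)}%qT.

Definition plus_class (U : C) (m : preplus U) : plus_sections U :=
  (\pi_({eq_quot (pp_equiv_rel U)}) (m : {classic preplus U}))%qT.

Definition plus_repr (U : C) (a : plus_sections U) : preplus U :=
  (repr (a : {eq_quot (pp_equiv_rel U)}))%qT.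

Lemma plus_reprK (U : C) : cancel (@plus_repr U) (@plus_class U).
Proof. by move=> a; apply: reprK. Qed.

Lemma plus_classP (U : C) (m n : preplus U) :
  plus_class m = plus_class n <-> pp_equiv m n.
Proof.
rewrite /plus_class; split=> [/eqquotP/asboolP //|mn].
by apply/eqquotP/asboolP.
Qed.

Definition plus_restr (U V : C) (f : hom V U) (a : plus_sections U)
    : plus_sections V :=
  plus_class (pp_restr f (plus_repr a)).

Lemma pp_restr_equiv (U V : C) (f : hom V U) (m n : preplus U) :
  pp_equiv m n -> pp_equiv (pp_restr f m) (pp_restr f n).
Proof.
move=> /pp_equivP[T [JT TR TS E]]; apply/pp_equivP.
exists (sieve_pull f T); split; first exact: cov_pull.
- by move=> W g /TR.
- by move=> W g /TS.
- by move=> W g p q /= Tfg; apply: E.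
Qed.

(* X^+(f)[m : R -> X] = [f^*(R) -> R -> X], for every representative m. *)
Lemma plus_restrE (U V : C) (f : hom V U) (m : preplus U) :
  plus_restr f (plus_class m) = plus_class (pp_restr f m).
Proof.
apply/plus_classP/pp_restr_equiv/plus_classP; exact: plus_reprK.
Qed.

Lemma plus_restr1 (U : C) (a : plus_sections U) : plus_restr (idm U) a = a.
Proof.
rewrite -[RHS]plus_reprK; apply/plus_classP/pp_equivP.
exists (pp_sieve (plus_repr a)); split=> //; first exact: pp_cov.
- by move=> V f /=; rewrite comp1m.
- move=> V f p q _ /=; congr (pp_map _ _ _).
  by apply: eq_exist; rewrite /= comp1m.
Qed.

Lemma plus_restrM (U V W : C) (f : hom V U) (g : hom W V) (a : plus_sections U) :
  plus_restr (f ∘ g) a = plus_restr g (plus_restr f a).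
Proof.
rewrite [in RHS]/plus_restr -/(plus_restr g _) plus_restrE.
apply/plus_classP/pp_equivP.
exists (sieve_pull (f ∘ g) (pp_sieve (plus_repr a))); split=> //.
- exact/cov_pull/pp_cov.
- by move=> Z h /=; rewrite compA.
- move=> Z h p q _ /=; congr (pp_map _ _ _).
  by apply: eq_exist; rewrite /= compA.
Qed.

Definition plus : presheaf C :=
  @Presheaf C plus_sections plus_restr plus_restr1 plus_restrM.

End Plus.

(* Main.v *)
(** Let [eta : X -> X^+] send [x] to the class of [y(U) -> X]; it is injective
    when [X] is separated.  For [a = [m : R -> X]] and [g] in [R] one has
    [a . g = eta (m g)], so a section of [X^+] is determined by its restrictions
    to a covering sieve.  To glue a family [s : R -> X^+], consider the sieve [S]
    of those [h] in [R] for which [s h] lies in the image of [eta]: it is covering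
    because each [s f] is locally in that image, and [h |-> eta^-1 (s h)] is a map
    [S -> X] whose class restricts to [s]. *)

Require Import Defs.
From mathcomp Require Import all_boot boolp.

Set Implicit Arguments.
Unset Strict Implicit.
Unset Printing Implicit Defensive.

Local Open Scope cat_scope.

Lemma sieve_restrictionP (C : category) (X : presheaf C) (U : C) (R : sieve U)
    (x : X U) (m : nat_trans (sieve_psh R) X) :
  sieve_restriction R x = m <->
  forall V (f : hom V U) (Rf : R V f), restr X f x = m V (exist _ f Rf).
Proof.
split=> [<- //|E]; apply: nat_trans_ext => V [f Rf]; exact: E.
Qed.

Lemma pp_map_comp (C : category) (J : coverage C) (X : presheaf C) (U V W : C)
    (m : preplus J X U) (f : hom V U) (g : hom W V)
    (p : pp_sieve m V f) (q : pp_sieve m W (f ∘ g)) :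
  pp_map m W (exist _ (f ∘ g) q) = restr X g (pp_map m V (exist _ f p)).
Proof. by rewrite -natural; congr (pp_map m W _); apply: eq_exist. Qed.

(** Pulling [S] back along an arrow of [R] gives the maximal sieve, so the local character of [J]
    applies. *)
Lemma cov_super (C : category) (J : coverage C) (U : C) (R S : sieve U) :
  J U R -> subsieve R S -> J U S.
Proof.
move=> JR RS; apply: (cov_local JR) => V g Rg.
suff -> : sieve_pull g S = max_sieve V by apply: cov_max.
by apply: sieve_ext => W f; split=> // _ /=; apply/sieve_closed/RS.
Qed.

Section Unit.
Variables (C : category) (J : coverage C) (X : presheaf C).

Definition plus_unit (U : C) (x : X U) : plus J X U :=
  plus_class (PrePlus (cov_max J U) (sieve_restriction (max_sieve U) x)).

(** As [g] lies in the domain of [m], its pullback along [g] is maximal, and a map out of the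
    maximal sieve is fixed by its value at the identity. *)
Lemma plus_restr_class (U V : C) (m : preplus J X U) (g : hom V U)
    (p : pp_sieve m V g) :
  restr (plus J X) g (plus_class m) = plus_unit (pp_map m V (exist _ g p)).
Proof.
rewrite /= plus_restrE; apply/plus_classP/pp_equivP.
exists (max_sieve V); split=> [|W f _ /=|//|W f q r _ /=]; first exact: cov_max.
  exact: sieve_closed.
exact: pp_map_comp.
Qed.

Lemma plus_unit_natural (U V : C) (g : hom V U) (x : X U) :
  restr (plus J X) g (plus_unit x) = plus_unit (restr X g x).
Proof.
pose m := PrePlus (cov_max J U) (sieve_restriction (max_sieve U) x).
exact: (@plus_restr_class U V m g I).
Qed.

Hypothesis sepX : separated J X.

Lemma plus_unit_inj (U : C) : injective (@plus_unit U).
Proof.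
move=> x y /plus_classP/pp_equivP[T [JT _ _ E]]; apply: (sepX JT).
by apply/sieve_restrictionP => V f; apply: E.
Qed.

(** On a cover [T] inside [R] and both domains, the restrictions are the units of the values of [m]
    and [n], which therefore agree by [plus_unit_inj]. *)
Lemma plus_separated : separated J (plus J X).
Proof.
move=> U R JR a b /sieve_restrictionP; rewrite -(plus_reprK a) -(plus_reprK b).
set m := plus_repr a; set n := plus_repr b => E.
have [S [JS SM SN]] := cov_meet (pp_cov m) (pp_cov n).
have [T [JT TR TS]] := cov_meet JR JS.
apply/plus_classP/pp_equivP; exists T; split=> //.
- by move=> V f /TS/SM.
- by move=> V f /TS/SN.
move=> V f p q Tf; apply: plus_unit_inj.
by rewrite -!plus_restr_class; apply: E; apply: TR.
Qed.

Section Glue.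
Variables (U : C) (R : sieve U) (JR : J U R).
Variable s : nat_trans (sieve_psh R) (plus J X).

Lemma family_comp (V W : C) (f : hom V U) (g : hom W V)
    (p : R V f) (q : R W (f ∘ g)) :
  s W (exist _ (f ∘ g) q) = restr (plus J X) g (s V (exist _ f p)).
Proof. by rewrite -natural; congr (s W _); apply: eq_exist. Qed.

Definition lifts (V : C) (f : hom V U) (x : X V) : Prop :=
  exists p : R V f, plus_unit x = s V (exist _ f p).

Lemma lifts_inj (V : C) (f : hom V U) (x y : X V) :
  lifts f x -> lifts f y -> x = y.
Proof.
move=> [p xE] [q yE]; apply: plus_unit_inj.
by rewrite xE yE (Prop_irrelevance p q).
Qed.

Lemma lifts_restr (V W : C) (f : hom V U) (g : hom W V) (x : X V) :
  lifts f x -> lifts (f ∘ g) (restr X g x).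
Proof.
move=> [p xE]; exists (sieve_closed g p).
by rewrite (family_comp p) -xE plus_unit_natural.
Qed.

Lemma liftable_closed (V W : C) (f : hom V U) (g : hom W V) :
  (exists x, lifts f x) -> exists x, lifts (f ∘ g) x.
Proof. by case=> x xP; exists (restr X g x); apply: lifts_restr. Qed.

Definition lift_sieve : sieve U := Sieve liftable_closed.

Lemma lift_sieve_cov : J U lift_sieve.
Proof.
apply: (cov_local JR) => V f Rf.
set m := plus_repr (s V (exist _ f Rf)).
(* Every arrow in the domain of a representative of [s f] gives a lift, namely the value of that
   representative. *)
apply: (cov_super (pp_cov m)) => W g Mg.
exists (pp_map m W (exist _ g Mg)); exists (sieve_closed g Rf).
by rewrite -plus_restr_class plus_reprK (family_comp Rf).
Qed.

(** Lifts are picked by choice; their uniqueness, [lifts_inj], is what makes the choice natural. *)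
Definition lift_map (V : C) (f : sieve_psh lift_sieve V) : X V :=
  sval (cid (proj2_sig f)).

Lemma lift_mapP (V : C) (f : sieve_psh lift_sieve V) :
  lifts (sval f) (lift_map f).
Proof. exact: svalP (cid (proj2_sig f)). Qed.

Lemma lift_map_natural (V W : C) (g : hom W V) (f : sieve_psh lift_sieve V) :
  lift_map (restr (sieve_psh lift_sieve) g f) = restr X g (lift_map f).
Proof.
apply: (@lifts_inj _ (sval f ∘ g)); last exact/lifts_restr/lift_mapP.
exact: (lift_mapP (restr (sieve_psh lift_sieve) g f)).
Qed.

Lemma plus_glue : exists a : plus J X U, sieve_restriction R a = s.
Proof.
pose m := PrePlus lift_sieve_cov (NatTrans lift_map_natural).
exists (plus_class m); apply/sieve_restrictionP => V f Rf.
(* [s f] itself need not lift, so the two sections are compared on the pullback of [lift_sieve]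
   along [f], where lifts exist. *)
apply: (plus_separated (cov_pull f lift_sieve_cov)).
apply/sieve_restrictionP => W g Sfg.
rewrite -restrM (@plus_restr_class _ _ m _ Sfg).
have [q ->] := lift_mapP (exist _ (f ∘ g) Sfg).
exact: family_comp.
Qed.

End Glue.
End Unit.

Theorem theorem7p27 (C : category) (J : coverage C) (X : presheaf C)
    (sepX : separated J X) : sheaf J (plus J X).
Proof.
move=> U R JR.
have [glue glueK] := choice (plus_glue sepX JR).
(* [glueK] makes [glue] a right inverse; injectivity of restriction makes it a left inverse too. *)
exists glue => // a; apply: (plus_separated sepX JR); exact: glueK.
Qed.
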